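(* Let $K$ be a positive integer, let $\mathcal P$ be an infinite set of prime numbers, and let $\varepsilon$ and $\kappa$ be positive real numbers with $\kappa<1$. For $k=1,\ldots,K$, let $\{a_{k,n}\}_{n=1}^\infty$ and $\{b_{k,n}\}_{n=1}^\infty$ be sequences of non-zero integers, and set $a_{0,n}=1$. Suppose that for all $p\in\mathcal P$ and $k=1,\ldots,K$: $p\nmid\gcd(a_{k,n},b_{k,n})$ for all $n$; for all sufficiently large $N$ there is exactly one $n\le N$ with $\nu_p(a_{k,n})=\max_{1\le m\le N}\nu_p(a_{k,m})$; and, if $k>1$, \[\lim_{N\to\infty}\frac{\max_{1\le n\le N}\nu_p(a_{k,n})}{1+\max_{1\le n\le N}\nu_p(a_{k-1,n})}=\infty.\] Suppose there is a non-decreasing sequence $\{a_n\}_{n=1}^\infty$ of positive integers and an integer $A_0$ such that for each $k=1,\ldots,K$, each integer $A\ge A_0$ and all sufficiently large $n$: \[ n^{1+\varepsilon}\le a_n\le a_{n+1},\qquad |b_{k,n}|\le 2^{(\log_2 a_n)^\kappa},\qquad a_n2^{-(\log_2 a_n)^\kappa}\le|a_{k,n}|\le\max\big\{a_n2^{(\log_2 a_n)^\kappa},2^{A^n}\big\},\] and for each integer $A\ge A_0$, $\limsup_{n\to\infty}a_n^{1/A^n}=\infty$. For $k=1,\ldots,K$ set $\alpha_k=\sum_{n=1}^\infty\frac{b_{k,n}}{a_{k,n}}$. Then $\alpha_1,\ldots,\alpha_K$ are algebraically independent over $\mathbb Q$.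
   Context: $\nu_p$ denotes the $p$-adic valuation. *)

(* Defs.v *)
From HB Require Import structures.
From mathcomp Require Import all_boot all_order all_algebra.
From mathcomp Require Import mpoly.
Set Implicit Arguments. Unset Strict Implicit. Unset Printing Implicit Defensive.
Import Order.TTheory GRing.Theory Num.Theory.
Local Open Scope ring_scope.

(* p-adic valuation of an integer (nu_p(0) = 0 by convention; only used on
   non-zero integers). *)
Definition nu (p : nat) (z : int) : nat := logn p `|z|%N.

Definition maxnu (p : nat) (x : nat -> int) (N : nat) : nat :=
  \max_(1 <= m < N.+1) nu p (x m).

Definition alg_indep_Q (R : unitRingType) (K : nat) (x : 'I_K -> R) : Prop :=
  forall P : {mpoly rat[K]}, P != 0 -> mmap (@ratr R) x P != 0.

(* Main.v *)
(** Suppose [F(alpha_1, ..., alpha_K) = 0] with [F] non-zero, and let [x_N] be the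
    vector of the [N]-th partial sums.

    [F(x_N)] is non-zero for large [N]: choose [p] in [P] at which all
    coefficients of [F] are units.  The [k]-th partial sum has [p]-adic valuation
    [- max_{n <= N} nu_p(a_{k,n})], and these maxima grow so much faster from each [k]
    to the next that distinct monomials of [F] take distinct valuations at [x_N].

    [F(x_N)] is too small along a subsequence: at a record [N+1] of
    [ln a_n / A^n], the product of all [|a_{k,n}|] with [n <= N] is at most a
    small power of [a_{N+1}], while the tails of the series are at most a fixed
    negative power of [a_{N+1}].  So after multiplication by a common denominator
    [F(x_N)] becomes a non-zero integer of absolute value less than 1. *)

Require Import Defs.
From HB Require Import structures.
From mathcomp Require Import all_boot all_order all_algebra.
From mathcomp Require Import all_classical all_reals all_analysis.
From mathcomp Require Import ring lra zify.
Import (canonicals) mpoly.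
Import Order.TTheory GRing.Theory Num.Theory.
Import numFieldNormedType.Exports.
Local Open Scope classical_set_scope.
Local Open Scope ring_scope.

(** * Integers and units of the localization of Z at a prime p *)

Section PadicUnits.
Variable p : nat.
Hypothesis p_prime : prime p.

(** The fraction need not be in lowest terms, so sums and products require no reduction and no
    valuation on the rationals has to be set up. *)
Definition padic_int (x : rat) : Prop :=
  exists u v : int, ~~ (p %| v)%Z /\ x = u%:~R / v%:~R.

Definition padic_unit (x : rat) : Prop :=
  exists u v : int, [/\ ~~ (p %| u)%Z, ~~ (p %| v)%Z & x = u%:~R / v%:~R].

Lemma prime_dvdzM (u v : int) : (p %| u * v)%Z = (p %| u)%Z || (p %| v)%Z.
Proof. by rewrite !dvdzE abszM Euclid_dvdM. Qed.

Lemma ndvdz_neq0 (v : int) : ~~ (p %| v)%Z -> v%:~R != 0 :> rat.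
Proof. by apply: contra; rewrite intr_eq0 => /eqP ->; rewrite dvdz0. Qed.

Lemma padic_int0 : padic_int 0.
Proof.
exists 0, 1; split; last by rewrite mul0r.
by rewrite dvdzE dvdn1 neq_ltn prime_gt1 ?orbT.
Qed.

Lemma padic_intD x y : padic_int x -> padic_int y -> padic_int (x + y).
Proof.
move=> [u [v [hv ->]]] [u' [v' [hv' ->]]].
exists (u * v' + u' * v), (v * v'); split.
  by rewrite prime_dvdzM negb_or hv.
rewrite addf_div ?ndvdz_neq0 //; by rewrite rmorphD /= !rmorphM.
Qed.

Lemma padic_intM x y : padic_int x -> padic_int y -> padic_int (x * y).
Proof.
move=> [u [v [hv ->]]] [u' [v' [hv' ->]]].
exists (u * u'), (v * v'); split; first by rewrite prime_dvdzM negb_or hv.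
by rewrite mulf_div !rmorphM.
Qed.

Lemma padic_unit_int x : padic_unit x -> padic_int x.
Proof. by move=> [u [v [_ hv ->]]]; exists u, v. Qed.

Lemma padic_int_natr n : padic_int n%:R.
Proof.
exists n%:Z, 1; split; last by rewrite divr1.
by rewrite dvdzE dvdn1 neq_ltn prime_gt1 ?orbT.
Qed.

Lemma padic_unit1 : padic_unit 1.
Proof.
have h : ~~ (p %| 1)%Z by rewrite dvdzE dvdn1 neq_ltn prime_gt1 ?orbT.
by exists 1, 1; split; rewrite ?divr1.
Qed.

Lemma padic_unitM x y : padic_unit x -> padic_unit y -> padic_unit (x * y).
Proof.
move=> [u [v [hu hv ->]]] [u' [v' [hu' hv' ->]]].
exists (u * u'), (v * v'); split; rewrite ?prime_dvdzM ?negb_or ?hu ?hv //.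
by rewrite mulf_div !rmorphM.
Qed.

Lemma padic_unitX x n : padic_unit x -> padic_unit (x ^+ n).
Proof.
move=> h; elim: n => [|n IH]; first exact: padic_unit1.
by rewrite exprS; apply: padic_unitM.
Qed.

Lemma padic_unit_prod (I : Type) (r : seq I) (F : I -> rat) :
  (forall i, padic_unit (F i)) -> padic_unit (\prod_(i <- r) F i).
Proof.
by move=> h; apply: big_ind => //; [exact: padic_unit1 | exact: padic_unitM].
Qed.

Lemma padic_unit_neq0 x : padic_unit x -> x != 0.
Proof.
move=> [u [v [hu hv ->]]].
by rewrite mulf_neq0 ?invr_eq0 ?ndvdz_neq0.
Qed.

Lemma padic_unitDp x y :
  padic_unit x -> padic_int y -> padic_unit (x + p%:R * y).
Proof.
move=> [u [v [hu hv ->]]] [u' [v' [hv' ->]]].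
exists (u * v' + p%:Z * (u' * v)), (v * v'); split.
- by rewrite rpredDr ?prime_dvdzM ?negb_or ?hu ?dvdzz.
- by rewrite prime_dvdzM negb_or hv.
rewrite rmorphD /= !rmorphM /= -pmulrn.
by field; rewrite !ndvdz_neq0.
Qed.

(** The ultrametric principle in the form used below: after scaling by a power of p, the unique term
    of least valuation decides. *)
Lemma padic_unit_sum (I : eqType) (r : seq I) (i0 : I) (F : I -> rat) :
  uniq r -> i0 \in r -> padic_unit (F i0) ->
  (forall i, i \in r -> i != i0 -> exists2 y, padic_int y & F i = p%:R * y) ->
  padic_unit (\sum_(i <- r) F i).
Proof.
move=> ur i0r h0 h; rewrite (bigD1_seq i0) //=.
suff [y hy ->] : exists2 y, padic_int y &
    \sum_(i <- r | i != i0) F i = p%:R * y by apply: padic_unitDp.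
rewrite big_seq_cond.
apply: (big_ind (fun z => exists2 y, padic_int y & z = p%:R * y)).
- by exists 0; rewrite ?mulr0 //; exact: padic_int0.
- move=> _ _ [y hy ->] [z hz ->].
  by exists (y + z); [exact: padic_intD | rewrite mulrDr].
- by move=> i /andP[]; apply: h.
Qed.

Lemma padic_unit_intr (z : int) : ~~ (p %| z)%Z -> padic_unit z%:~R.
Proof.
move=> h; exists z, 1; split => //; last by rewrite divr1.
by rewrite dvdzE dvdn1 neq_ltn prime_gt1 ?orbT.
Qed.

Lemma padic_unitV x : padic_unit x -> padic_unit x^-1.
Proof. by move=> [u [v [hu hv ->]]]; exists v, u; rewrite invf_div. Qed.

Lemma nu_factor (z : int) : z != 0 ->
  exists2 w, padic_unit w & z%:~R = p%:R ^+ nu p z * w.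
Proof.
move=> z0; have z1 : (0 < `|z|)%N by rewrite absz_gt0.
have [m] := pfactor_coprime p_prime z1; rewrite prime_coprime // => hm e.
(* [m] is the part of [|z|] prime to p; the sign of [z] has to be restored. *)
exists ((-1) ^+ (z < 0)%R * m%:R).
  have -> : (-1) ^+ (z < 0)%R * m%:R = ((-1) ^+ (z < 0)%R * m%:Z)%:~R :> rat.
    by rewrite rmorphM /= rmorph_sign.
  apply: padic_unit_intr; rewrite prime_dvdzM negb_or; apply/andP; split.
    by rewrite dvdzE absz_sign dvdn1 neq_ltn prime_gt1 ?orbT.
  by rewrite dvdzE.
rewrite {1}[z]intEsign e -/(nu p z) rmorphM /= rmorph_sign.
rewrite -pmulrn natrM natrX; ring.
Qed.

End PadicUnits.

(** * Polynomials at points with lacunary p-adic valuations *)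

(** As for digits in a positional system: at the largest index where [f] and [g] differ, the
    difference contributes at least [M k], more than the lower indices can make up with coefficients
    at most [D]. *)
Lemma dominated_weight_inj (K D : nat) (M f g : 'I_K -> nat) :
  (forall k : 'I_K, (D * \sum_(j < K | (j < k)%N) M j < M k)%N) ->
  (forall k, (f k <= D)%N) -> (forall k, (g k <= D)%N) ->
  (\sum_k f k * M k = \sum_k g k * M k)%N -> f =1 g.
Proof.
move=> hM hf hg hsum k0; apply/eqP/negPn/negP => hk0.
case: (@arg_maxnP _ k0 (fun k => f k != g k) (fun k => k : nat) hk0) => k hk kmax.
have above (j : 'I_K) : (k < j)%N -> f j = g j.
  move=> kj; apply/eqP/negPn/negP => hj.
  by have := kmax j hj; rewrite /= leqNgt kj.
clear k0 hk0 kmax.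
wlog lt_gf : f g hf hg hsum hk above / (g k < f k)%N.
  move=> hw; have [h|h] := ltnP (g k) (f k); first exact: (hw f g).
  apply: (hw g f) => //; first by rewrite eq_sym.
    by move=> j /above.
  by rewrite ltn_neqAle hk h.
suff : (\sum_k g k * M k < \sum_k f k * M k)%N by rewrite hsum ltnn.
have split3 (h : 'I_K -> nat) : (\sum_j h j * M j =
    h k * M k + \sum_(j < K | (j < k)%N) h j * M j
      + \sum_(j < K | (k < j)%N) h j * M j)%N.
  rewrite (bigD1 k) //= -addnA; congr addn.
  rewrite (bigID (fun j : 'I_K => (j < k)%N)) /=; congr addn; apply: eq_bigl => j.
    by rewrite -val_eqE /=; lia.
  by rewrite -val_eqE /=; lia.
rewrite !split3 (eq_bigr (fun j => f j * M j)%N (P := fun j : 'I_K => (k < j)%N)); last first.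
  by move=> j /above ->.
rewrite ltn_add2r.
have low : (\sum_(j < K | (j < k)%N) g j * M j <= D * \sum_(j < K | (j < k)%N) M j)%N.
  by rewrite big_distrr; apply: leq_sum => j _; rewrite leq_mul2r hg orbT.
have := hM k; nia.
Qed.

Section LacunaryEvaluation.
Variables (K : nat) (I : eqType) (r : seq I) (c : I -> rat).
Variable e : I -> 'I_K -> nat.

(** As [q k] has valuation [- M k], the term of [m] has valuation [- W m], where [W m] is its
    weight. Injectivity leaves a single term of largest weight; multiplication by p to that weight
    makes it a unit and every other term divisible by p. *)
Lemma padic_eval_neq0 (p : nat) (M : 'I_K -> nat) (q : 'I_K -> rat) :
  prime p -> uniq r -> r != [::] ->
  (forall m, m \in r -> padic_unit p (c m)) ->
  (forall k, padic_unit p (p%:R ^+ M k * q k)) ->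
  {in r &, injective (fun m => \sum_k e m k * M k)%N} ->
  \sum_(m <- r) c m * \prod_k q k ^+ e m k != 0.
Proof.
move=> pp ur rn0 hc hq inj.
pose W m := (\sum_k e m k * M k)%N.
pose U m := c m * \prod_k (p%:R ^+ M k * q k) ^+ e m k.
have WU m : p%:R ^+ W m * (c m * \prod_k q k ^+ e m k) = U m.
  rewrite /U mulrCA; congr (_ * _).
  rewrite /W expr_sum -big_split /=; apply: eq_bigr => k _.
  by rewrite exprMn -exprM mulnC.
have hU m : m \in r -> padic_unit p (U m).
  move=> mr; apply: (padic_unitM p pp); first exact: hc.
  by apply: (padic_unit_prod p pp) => k; apply: padic_unitX.
have [m0 m0r m0max] : exists2 m0, m0 \in r & forall m, m \in r -> (W m <= W m0)%N.
  case: r rn0 => // x s _; elim: s x => [|y s IH] x.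
    by exists x; rewrite ?inE // => m; rewrite inE => /eqP ->.
  have [m1 h1 h2] := IH y.
  have [le|lt] := leqP (W x) (W m1).
    exists m1; first by rewrite inE h1 orbT.
    by move=> m; rewrite inE => /predU1P[->|/h2].
  exists x; first by rewrite mem_head.
  by move=> m; rewrite inE => /predU1P[->|/h2 h] //; apply: leq_trans h (ltnW lt).
have p0 : (p%:R : rat) != 0 by rewrite pnatr_eq0 -lt0n prime_gt0.
suff : p%:R ^+ W m0 * (\sum_(m <- r) c m * \prod_k q k ^+ e m k) != 0.
  by rewrite mulf_eq0 negb_or => /andP[].
rewrite mulr_sumr; apply: (padic_unit_neq0 p).
apply: (padic_unit_sum p pp _ _ m0) => //; first by rewrite WU; apply: hU.
move=> m mr mm0.
have lt : (W m < W m0)%N.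
  rewrite ltn_neqAle m0max // andbT; apply: contra mm0 => /eqP h.
  by apply/eqP/inj.
(* One factor p is split off; the exponent left is non-negative because [W m < W m0]. *)
exists (p%:R ^+ (W m0 - (W m).+1) * U m); last first.
  by rewrite -WU !mulrA -exprS -exprD; congr (_ ^+ _ * _ * _); lia.
apply: (padic_intM p pp); last exact/(padic_unit_int p)/hU.
by rewrite -natrX; apply: padic_int_natr.
Qed.

(** Every exponent is at most [D], so [Q k ^+ D] contains the factor [Q k ^+ e m k] that clears
    [q k ^+ e m k]. *)
Lemma cleared_eval_int (D : nat) (d : int) (Q : 'I_K -> int) (q : 'I_K -> rat) :
  (forall m, m \in r -> d%:~R * c m \is a Num.int) ->
  (forall m k, m \in r -> (e m k <= D)%N) ->
  (forall k, (Q k)%:~R * q k \is a Num.int) ->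
  d%:~R * (\prod_k (Q k)%:~R ^+ D) * \sum_(m <- r) c m * \prod_k q k ^+ e m k
    \is a Num.int.
Proof.
move=> hd hD hQ; rewrite mulr_sumr big_seq; apply: rpred_sum => m mr.
rewrite mulrACA; apply: rpredM; first exact: hd.
rewrite -big_split /=; apply: rpred_prod => k _.
rewrite -(subnK (hD m k mr)) exprD -mulrA -exprMn.
by apply: rpredM; apply: rpredX; [exact: rpred_int | exact: hQ].
Qed.

End LacunaryEvaluation.

(** After scaling, the only term attaining the maximum becomes [b n0 / w] with [w] a unit, while all
    others keep a factor p. *)
Lemma partial_sum_padic_unit (p N : nat) (a b : nat -> int) :
  prime p -> (1 < N)%N -> (forall n, (1 <= n)%N -> a n != 0) ->
  (forall n, (1 <= n)%N -> ~~ (p %| gcdn `|a n| `|b n|)%N) ->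
  (exists! n, (1 <= n <= N)%N /\ nu p (a n) = maxnu p a N) ->
  padic_unit p (p%:R ^+ maxnu p a N * \sum_(1 <= n < N.+1) (b n)%:~R / (a n)%:~R).
Proof.
move=> pp N1 a0 gab [n0 [[n0N n0M] n0u]].
have p0 : (p%:R : rat) != 0 by rewrite pnatr_eq0 -lt0n prime_gt0.
have le_max n : (1 <= n <= N)%N -> (nu p (a n) <= maxnu p a N)%N.
  move=> nN; rewrite /maxnu.
  by apply: (@leq_bigmax_seq _ _ xpredT (fun m => nu p (a m))); rewrite ?mem_index_iota.
have lt_max n : (1 <= n <= N)%N -> n != n0 -> (nu p (a n) < maxnu p a N)%N.
  move=> nN nn0; rewrite ltn_neqAle le_max // andbT.
  by apply: contra nn0 => /eqP h; rewrite (n0u n).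
(* Since [N >= 2], some index other than [n0] lies strictly below the maximum. Hence p divides
   [a n0], and coprimality makes [b n0] a unit. *)
have Mpos : (0 < maxnu p a N)%N.
  have [n01|n01] := eqVneq n0 1%N.
    by apply: leq_ltn_trans (lt_max 2 _ _); rewrite ?n01.
  by apply: leq_ltn_trans (lt_max 1%N _ _); rewrite // ?(ltnW N1) // eq_sym.
rewrite mulr_sumr.
apply: (padic_unit_sum p pp _ _ n0); rewrite ?iota_uniq ?mem_index_iota //.
  have [w hw ->] := nu_factor p pp (a n0) (a0 _ (proj1 (andP n0N))).
  have -> : p%:R ^+ maxnu p a N * ((b n0)%:~R / (p%:R ^+ nu p (a n0) * w)) =
      (b n0)%:~R / w.
    have w0 := padic_unit_neq0 p _ hw.
    by rewrite n0M; field; rewrite w0 expf_neq0.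
  apply: padic_unitM => //; last exact: padic_unitV.
  apply: padic_unit_intr => //; apply/negP => pb.
  have /negP := gab n0 (proj1 (andP n0N)); apply.
  rewrite dvdn_gcd (_ : (p %| `|b n0|)%N) ?andbT; last by rewrite dvdzE in pb.
  by move: Mpos; rewrite -n0M /nu logn_gt0 mem_primes => /and3P[].
move=> n; rewrite mem_index_iota ltnS => nN nn0.
have [w hw ->] := nu_factor p pp (a n) (a0 _ (proj1 (andP nN))).
have lt := lt_max n nN nn0.
exists (p%:R ^+ (maxnu p a N - (nu p (a n)).+1) * ((b n)%:~R / w)).
  apply: padic_intM => //; first by rewrite -natrX; apply: padic_int_natr.
  apply: padic_intM => //; last exact/(padic_unit_int p)/padic_unitV.
  exists (b n), 1; split; last by rewrite divr1.
  by rewrite dvdzE dvdn1 neq_ltn prime_gt1 ?orbT.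
rewrite -{1}(subnK lt) addnS exprS exprD.
have w0 := padic_unit_neq0 p _ hw.
have pn0 : (p%:R : rat) ^+ nu p (a n) != 0 by rewrite expf_neq0.
by field; rewrite w0 pn0.
Qed.

(** * Size and Lipschitz bounds for polynomials on a box *)

Section LipschitzOnBox.
Variables (R : realDomainType) (K : nat) (B : R).

(** A single [C] bounds both values and difference quotients, which makes the notion stable under
    products. The common bound [d] on the coordinates stands for the sup norm. *)
Definition lipschitz_on_box (f : ('I_K -> R) -> R) : Prop :=
  exists2 C, 0 <= C & forall x y d,
    (forall k, `|x k| <= B) -> (forall k, `|y k| <= B) ->
    (forall k, `|x k - y k| <= d) -> 0 <= d ->
    `|f x| <= C /\ `|f x - f y| <= C * d.

Lemma lipschitz_on_box_cst c : lipschitz_on_box (fun=> c).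
Proof.
exists `|c| => // x y d _ _ _ d0; split=> //.
by rewrite subrr normr0 mulr_ge0.
Qed.

Lemma lipschitz_on_box_coord k : lipschitz_on_box (fun x => x k).
Proof.
(* [|B|] serves the size and 1 the Lipschitz ratio; the absolute value keeps the constant
   non-negative whatever the sign of [B]. *)
exists (`|B| + 1); first by rewrite addr_ge0.
move=> x y d hx hy hd d0; split.
  by apply: le_trans (hx k) _; rewrite (le_trans (ler_norm B)) // lerDl.
by rewrite mulrDl mul1r (le_trans (hd k)) // lerDr mulr_ge0.
Qed.

Lemma lipschitz_on_boxD f g : lipschitz_on_box f -> lipschitz_on_box g ->
  lipschitz_on_box (fun x => f x + g x).
Proof.
move=> [C C0 hf] [C' C'0 hg]; exists (C + C'); first exact: addr_ge0.
move=> x y d hx hy hd d0.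
have [f1 f2] := hf x y d hx hy hd d0; have [g1 g2] := hg x y d hx hy hd d0.
split; first exact: le_trans (ler_normD _ _) (lerD f1 g1).
rewrite opprD addrACA mulrDl.
exact: le_trans (ler_normD _ _) (lerD f2 g2).
Qed.

Lemma lipschitz_on_boxM f g : lipschitz_on_box f -> lipschitz_on_box g ->
  lipschitz_on_box (fun x => f x * g x).
Proof.
move=> [C C0 hf] [C' C'0 hg]; exists (2 * (C * C')).
  by rewrite !mulr_ge0.
move=> x y d hx hy hd d0.
have [f1 f2] := hf x y d hx hy hd d0; have [g1 g2] := hg x y d hx hy hd d0.
(* The pair [y], [y] at distance 0 yields the bound on [|g y|]. *)
have [g3 _] := hg y y 0 hy hy (fun k => ltac:(by rewrite subrr normr0)) (lexx _).
split.
  rewrite normrM (le_trans (ler_pM _ _ f1 g1)) //.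
  by rewrite ler_peMl ?mulr_ge0 ?ler1n.
have -> : f x * g x - f y * g y = f x * (g x - g y) + (f x - f y) * g y by ring.
apply: le_trans (ler_normD _ _) _; rewrite !normrM.
apply: le_trans (lerD (ler_pM _ _ f1 g2) (ler_pM _ _ f2 g3)) _ => //.
by rewrite le_eqVlt; apply/orP; left; apply/eqP; ring.
Qed.

Lemma lipschitz_on_box_eval (I : Type) (r : seq I) (c : I -> R)
    (e : I -> 'I_K -> nat) :
  lipschitz_on_box (fun x => \sum_(m <- r) c m * \prod_k x k ^+ e m k).
Proof.
have lipX k n : lipschitz_on_box (fun x => x k ^+ n).
  elim: n => [|n IH]; first exact: lipschitz_on_box_cst.
  have [C C0 h] := lipschitz_on_boxM _ _ (lipschitz_on_box_coord k) IH.
  by exists C => // x y d hx hy hd d0; have := h x y d hx hy hd d0; rewrite !exprS.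
have lip_prod (s : seq 'I_K) m : lipschitz_on_box (fun x => \prod_(k <- s) x k ^+ e m k).
  elim: s => [|k s IH].
    have [C C0 h] := lipschitz_on_box_cst 1; exists C => // x y d hx hy hd d0.
    by rewrite !big_nil; exact: (h x y d).
  have [C C0 h] := lipschitz_on_boxM _ _ (lipX k (e m k)) IH.
  exists C => // x y d hx hy hd d0.
  by rewrite !big_cons; exact: (h x y d).
elim: r => [|m s IH].
  have [C C0 h] := lipschitz_on_box_cst 0; exists C => // x y d hx hy hd d0.
  by rewrite !big_nil; exact: (h x y d).
have [C C0 h] := lipschitz_on_boxD _ _
  (lipschitz_on_boxM _ _ (lipschitz_on_box_cst (c m)) (lip_prod (index_enum 'I_K) m)) IH.
by exists C => // x y d hx hy hd d0; rewrite !big_cons; exact: (h x y d).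
Qed.

End LipschitzOnBox.

(** * Tails of series with terms at most exp(-(1 - 2 eta) L n), [L n] standing for ln a_n *)

Section SeriesTails.
Variable R : realType.

(* [(n+1)^-e (exp (e / (n+1)) - 1) <= n^-e - (n+1)^-e], as [ln (1 - 1/(n+1)) <= -1/(n+1)]. *)
Lemma powRN_telescope (e : R) (n : nat) : 0 < e -> (0 < n)%N ->
  expR (- (1 + e) * ln n.+1%:R) <=
  e^-1 * (expR (- e * ln n%:R) - expR (- e * ln n.+1%:R)).
Proof.
move=> e0 n0; rewrite -[leLHS]mul1r -[X in X * _ <= _](mulVf (lt0r_neq0 e0)).
rewrite -mulrA ler_pM2l ?invr_gt0 //.
have np : 0 < n%:R :> R by rewrite ltr0n.
have n1p : 0 < n.+1%:R :> R by rewrite ltr0n.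
have -> : - (1 + e) * ln n.+1%:R = - e * ln n.+1%:R - ln n.+1%:R :> R by ring.
rewrite [in leLHS]expRD expRN lnK ?posrE //.
have hl : ln n%:R - ln n.+1%:R <= - n.+1%:R^-1 :> R.
  rewrite -ln_div ?posrE //.
  have -> : n%:R / n.+1%:R = 1 + - n.+1%:R^-1 :> R.
    have h : n.+1%:R != 0 :> R by rewrite lt0r_neq0.
    by apply: (mulIf h); rewrite mulfVK // mulrDl mulNr mulVf // -natr1 mul1r addrK.
  apply: le_ln1Dx; rewrite ltrN2 invf_lt1 //.
  by rewrite ltr1n ltnS.
have -> : - e * ln n%:R = - e * ln n.+1%:R + - e * (ln n%:R - ln n.+1%:R) by ring.
rewrite expRD.
set E := expR (- e * ln n.+1%:R); have E0 : 0 < E by exact: expR_gt0.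
have h1 : 1 + e / n.+1%:R <= expR (- e * (ln n%:R - ln n.+1%:R)).
  apply: le_trans (expR_ge1Dx _); rewrite lerD2l mulNr -mulrN ler_wpM2l ?(ltW e0) //.
  by rewrite lerNr.
rewrite [leLHS]mulrCA -[X in _ - X]mulr1 -mulrBr ler_pM2l //.
by rewrite lerBrDl.
Qed.

(** The bounds of [powRN_telescope] collapse to at most [e^-1 N^-e], and [N >= 1]. *)
Lemma sum_powRN_le (e : R) (N M : nat) : 0 < e -> (0 < N)%N ->
  \sum_(N.+1 <= n < M) expR (- (1 + e) * ln n%:R) <= e^-1.
Proof.
move=> e0 N0; have [NM|MN] := leqP N.+1 M; last first.
  by rewrite big_geq ?invr_ge0 ?ltW // ltnW.
case: M NM => // M; rewrite ltnS => NM.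
rewrite big_add1 /=.
apply: (@le_trans _ _ (\sum_(N <= n < M)
    e^-1 * (expR (- e * ln n%:R) - expR (- e * ln n.+1%:R)))).
  apply: ler_sum_nat => n /andP[Nn _]; apply: powRN_telescope => //.
  exact: leq_trans Nn.
rewrite -mulr_sumr ler_piMr ?invr_ge0 ?(ltW e0) //.
rewrite (eq_bigr (fun n => - expR (- e * ln n.+1%:R) - - expR (- e * ln n%:R))).
  rewrite (telescope_sumr (fun n => - expR (- e * ln n%:R))) //.
  have h1 : expR (- e * ln N%:R) <= 1.
    by rewrite -[leRHS]expR0 ler_expR mulNr oppr_le0 mulr_ge0 ?(ltW e0) ?ln_ge0 ?ler1n.
  have := expR_ge0 (- e * ln M%:R); move: h1; lra.
by move=> n _; rewrite opprK addrC.
Qed.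

Section Tail.
Variables (t L : nat -> R) (eps : R) (n0 : nat).
Hypothesis eps_gt0 : 0 < eps.
Hypothesis n0_gt0 : (0 < n0)%N.
Hypothesis L_mono : forall m n, (n0 <= m)%N -> (m <= n)%N -> L m <= L n.
Hypothesis L_ge : forall n, (n0 <= n)%N -> (1 + eps) * ln n%:R <= L n.
Let eta := eps / (4 * (1 + eps)).
Hypothesis t_le : forall n, (n0 <= n)%N -> `|t n| <= expR (- (1 - 2 * eta) * L n).

(* The exponent splits as [1 - 2 eta = eta + (1 - 3 eta)], where [eta] is chosen
   so that [(1 - 3 eta) (1 + eps) = 1 + eps / 4] still exceeds 1. *)
Lemma tail_sum_le (N M : nat) : (n0 <= N)%N ->
  \sum_(N.+1 <= n < M) `|t n| <= expR (- eta * L N.+1) * (4 / eps).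
Proof.
move=> n0N.
have eps1 : 1 + eps != 0 by rewrite lt0r_neq0 // addr_gt0.
have eta0 : 0 < eta by rewrite divr_gt0 // mulr_gt0 // addr_gt0.
have eta4 : 4 * eta * (1 + eps) = eps by rewrite /eta; field.
apply: (@le_trans _ _ (\sum_(N.+1 <= n < M)
    expR (- eta * L N.+1) * expR (- (1 + eps / 4) * ln n%:R))); last first.
  rewrite -mulr_sumr ler_wpM2l ?expR_ge0 //.
  rewrite -[4 / eps]invf_div sum_powRN_le ?divr_gt0 //.
  exact: leq_trans n0N.
apply: ler_sum_nat => n /andP[Nn _].
have n0n : (n0 <= n)%N by apply: leq_trans n0N (ltnW Nn).
apply: le_trans (t_le n n0n) _; rewrite -expRD ler_expR.
have h1 : L N.+1 <= L n by apply: L_mono => //; apply: leq_trans n0N _.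
have h2 := L_ge n n0n.
have e3 : 0 <= 1 - 3 * eta.
  suff : eta < 1 / 4 by lra.
  by rewrite ltr_pdivrMr ?mulr_gt0 ?addr_gt0 //; move: eps_gt0; lra.
have h3 : (1 - 3 * eta) * ((1 + eps) * ln n%:R) <= (1 - 3 * eta) * L n.
  by rewrite ler_wpM2l.
have e4 : (1 - 3 * eta) * (1 + eps) = 1 + eps / 4 by rewrite /eta; field.
rewrite mulrA e4 in h3.
have h4 : eta * L N.+1 <= eta * L n by rewrite ler_wpM2l // ltW.
lra.
Qed.

(** [tail_sum_le] bounds the partial sums of [|t n|], which gives convergence; letting its upper end
    tend to infinity bounds the remainder. As [u N] stops before index [N], the N-th partial sum is
    [u N.+1]. *)
Lemma tail_limit_le :
  let u := fun N => \sum_(1 <= n < N) t n in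
  cvgn u /\ forall N, (n0 <= N)%N ->
    `|limn u - u N.+1| <= expR (- eta * L N.+1) * (4 / eps).
Proof.
move=> u.
(* [series] starts at index 0 whereas [u] starts at 1. *)
have u_series : [sequence u n.+1]_n = series (fun n => t n.+1).
  by apply/funext => N; rewrite /u /series /= big_add1.
have cs : cvgn (series (fun n => t n.+1)).
  apply: normed_cvg; apply: nondecreasing_is_cvgn.
    by apply: nondecreasing_series => n _ _; rewrite normr_ge0.
  exists (\sum_(1 <= n < n0.+1) `|t n| + expR (- eta * L n0.+1) * (4 / eps)).
  move=> _ [N _ <-].
  have -> : [normed series (fun n => t n.+1)] N = \sum_(1 <= n < N.+1) `|t n|.
    by rewrite /series /= big_add1.
  have [le|lt] := leqP n0 N.
    rewrite (@big_cat_nat _ _ _ n0.+1) //=; first by rewrite lerD2l tail_sum_le.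
  rewrite (@big_cat_nat _ _ _ N.+1 1 n0.+1) ?ltnS ?(ltnW lt) //= -addrA lerDl.
  apply: addr_ge0; first by apply: sumr_ge0 => n _.
  by rewrite mulr_ge0 ?expR_ge0 // divr_ge0 // ltW.
have cu : u @ \oo --> limn (series (fun n => t n.+1)).
  by rewrite -(cvg_shiftS u) u_series.
split; first by apply/cvg_ex; eexists; exact: cu.
move=> N n0N.
have cu' : `|u M - u N.+1| @[M --> \oo] --> `|limn u - u N.+1|.
  apply: cvg_norm; apply: cvgB; last exact: cvg_cst.
  by apply/cvg_ex; eexists; exact: cu.
rewrite -(cvg_lim _ cu') //; apply: limr_le; first by apply/cvg_ex; eexists; exact: cu'.
near=> M.
have NM : (N.+1 <= M)%N by near: M; exact: nbhs_infty_ge.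
rewrite /u (@big_cat_nat _ _ _ N.+1 1 M) //= addrAC subrr add0r.
exact: le_trans (ler_norm_sum _ _ _) (tail_sum_le N M n0N).
Unshelve. all: by end_near.
Qed.

End Tail.
End SeriesTails.

(** * Growth estimates and records *)

Section Growth.
Variable R : realType.

(** The limsup is an infimum of suprema of tails, so a bound [B] valid from [N] on would bound it
    too. *)
Lemma limn_esup_pinfty_unbounded (u : nat -> R) :
  limn_esup (fun n => (u n)%:E) = +oo%E ->
  forall B N, exists2 n, (N <= n)%N & B <= u n.
Proof.
move=> h B N; apply: contrapT => H.
suff : (limn_esup (fun n => (u n)%:E) <= B%:E)%E by rewrite h leye_eq.
apply: (@le_trans _ _ (ereal_sup [set (u n)%:E | n in [set n | (N <= n)%N]])).
  apply: ereal_inf_lbound; exists [set n | (N <= n)%N] => //.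
  exact: nbhs_infty_ge.
apply: ge_ereal_sup => _ [n /= Nn <-]; rewrite lee_fin leNgt.
by apply/negP => Bn; apply: H; exists n => //; apply: ltW.
Qed.

(** The record is the least index beyond [N0] at which [r] reaches [M]. Values up to [N0] are below
    [M] by its definition, later ones by minimality. *)
Lemma exists_record (r : nat -> R) :
  (forall B N, exists2 n, (N <= n)%N & B <= r n) ->
  forall N0, exists N, [/\ (N0 <= N)%N, 1 <= r N.+1 &
    forall n, (n <= N)%N -> r n <= r N.+1].
Proof.
move=> unb N0; pose M := 1 + \sum_(n < N0.+1) `|r n|.
have exP : exists n, (N0 < n)%N && (M <= r n).
  by have [n h1 h2] := unb M N0.+1; exists n; rewrite h1.
case: (ex_minnP exP) => -[|N] /andP[N0N MN] minN //.
exists N; split=> //.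
  by apply: le_trans MN; rewrite lerDl sumr_ge0.
move=> n nN; apply: le_trans MN.
have [n0|n0] := leqP n N0.
  have nlt : (n < N0.+1)%N by [].
  rewrite /M (bigD1 (Ordinal nlt)) //= addrCA.
  rewrite (le_trans (ler_norm _)) // lerDl addr_ge0 // sumr_ge0 //.
apply/ltW; rewrite ltNge; apply/negP => h.
by have := minN n; rewrite n0 h => /(_ isT); rewrite leqNgt ltnS nN.
Qed.

(** The bound increases by exactly [A ^+ n] from [n] to [n.+1]. *)
Lemma sum_geometric_le (A : R) (m n : nat) : 1 < A -> (m <= n)%N ->
  \sum_(m <= i < n) A ^+ i <= A ^+ n / (A - 1).
Proof.
move=> A1; have A0 : 0 < A - 1 by rewrite subr_gt0.
have A0' : 0 < A by apply: lt_trans A1.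
move=> /subnK <-; elim: (n - m)%N => [|d IH].
  by rewrite add0n big_geq // divr_ge0 ?exprn_ge0 // ltW.
rewrite addSn big_nat_recr ?leq_addl //=.
apply: le_trans (lerD IH (lexx _)) _.
rewrite le_eqVlt; apply/orP; left; apply/eqP; rewrite exprS.
by field; rewrite lt0r_neq0.
Qed.

(** At a record, [2 L n + A^n <= 3 rho A^n], and the exponents add up geometrically; the factors
    below [n0] go into [C]. The point is the coefficient [3 / (A - 1)], which is small for large
    [A]. *)
Lemma record_prod_le (a : nat -> int) (L : nat -> R) (A : R) (n0 : nat) :
  1 < A -> (0 < n0)%N -> (forall n, (n0 <= n)%N ->
    `|(a n)%:~R| <= expR (2 * L n + A ^+ n)) ->
  exists2 C, 0 <= C & forall N rho, (n0 <= N)%N -> 1 <= rho ->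
    (forall n, (n <= N)%N -> L n <= rho * A ^+ n) ->
    `|\prod_(1 <= n < N.+1) (a n)%:~R| <= C * expR (3 / (A - 1) * (rho * A ^+ N.+1)).
Proof.
move=> A1 n00 ha; have A0 : 0 < A - 1 by rewrite subr_gt0.
exists `|\prod_(1 <= n < n0) (a n)%:~R| => // N rho n0N rho1 hL.
have rho0 : 0 <= rho by apply: le_trans rho1.
rewrite (@big_cat_nat _ _ _ n0) //=; last exact: leqW.
rewrite normrM ler_wpM2l //.
apply: (@le_trans _ _ (\prod_(n0 <= n < N.+1) expR (3 * rho * A ^+ n))).
  rewrite normr_prod big_nat [leRHS]big_nat; apply: ler_prod => n /andP[h1 h2].
  rewrite normr_ge0 /=; apply: le_trans (ha n h1) _; rewrite ler_expR.
  have h3 := hL n h2.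
  have h4 : A ^+ n <= rho * A ^+ n.
    by rewrite ler_peMl // exprn_ge0 // (le_trans ler01) // ltW.
  lra.
rewrite -expR_sum ler_expR -mulr_sumr.
have := sum_geometric_le A n0 N.+1 A1 (leqW n0N).
move/(ler_wpM2l (mulr_ge0 (ler0n R 3) rho0)) => h; apply: le_trans h _.
by rewrite le_eqVlt; apply/orP; left; apply/eqP; field; rewrite lt0r_neq0.
Qed.

Lemma powR_sublinear (kappa eta : R) : 0 < kappa < 1 -> 0 < eta ->
  exists2 X, 0 < X & forall x : R, X <= x -> x `^ kappa <= eta * x.
Proof.
move=> /andP[k0 k1] eta0.
have k1' : 0 < 1 - kappa by rewrite subr_gt0.
(* This is the positive solution of [x^kappa = eta x]. *)
exists (eta^-1 `^ (1 - kappa)^-1); first by rewrite powR_gt0 ?invr_gt0.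
move=> x Xx; have x0 : 0 < x.
  by apply: lt_le_trans Xx; rewrite powR_gt0 ?invr_gt0.
have h : eta^-1 <= x `^ (1 - kappa).
  have := ge0_ler_powR (ltW k1') _ _ Xx.
  rewrite !nnegrE powR_ge0 (ltW x0) => /(_ isT isT).
  by rewrite -powRrM mulVf ?lt0r_neq0 // powRr1 // invr_ge0 ltW.
rewrite -(mulr_powRB1 (ltW x0) k0) mulrC ler_wpM2r ?(ltW x0) //.
rewrite -opprB powRN -[leRHS]invrK lef_pV2 ?posrE ?invr_gt0 //.
by rewrite powR_gt0.
Qed.

(** The factor [2^((log_2 S)^kappa)] is at most [S^eta]. Hence [|b / a|] is at most
    [S^eta / S^(1 - eta)], and the maximum is bounded through [S^(1 + eta) <= S^2] and
    [2^An <= e^An]. *)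
Lemma growth_bounds (S eps kappa eta An a b : R) (n : nat) :
  0 < eps -> 0 <= eta <= 1 -> 0 <= An -> (0 < n)%N -> 1 <= S ->
  (ln S / ln 2) `^ kappa <= eta * (ln S / ln 2) ->
  [/\ n%:R `^ (1 + eps) <= S, `|b| <= 2 `^ ((ln S / ln 2) `^ kappa),
      S * 2 `^ (- (ln S / ln 2) `^ kappa) <= `|a|
    & `|a| <= Num.max (S * 2 `^ ((ln S / ln 2) `^ kappa)) (2 `^ An)] ->
  [/\ (1 + eps) * ln n%:R <= ln S,
      `|b / a| <= expR (- (1 - 2 * eta) * ln S)
    & `|a| <= expR (2 * ln S + An)].
Proof.
move=> eps0 /andP[eta0 eta1] An0 n0 S1 hk [h1 h2 h3 h4].
have S0 : 0 < S by apply: lt_le_trans S1.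
have l20 : 0 < ln 2 :> R by rewrite ln_gt0 // ltr1n.
have l21 : ln 2 <= 1 :> R.
  by have := @le_ln1Dx R 1; apply; rewrite (lt_trans _ ltr01) // ltrN10.
have L0 : 0 <= ln S by apply: ln_ge0.
set T := (ln S / ln 2) `^ kappa in hk h2 h3 h4.
have hT : T * ln 2 <= eta * ln S.
  by move: hk; rewrite mulrA -ler_pdivlMr //.
have pow2 x : 2 `^ x = expR (x * ln 2) :> R by rewrite /powR pnatr_eq0.
have ES : expR (ln S) = S by rewrite lnK.
rewrite !pow2 -{1}ES -expRD mulNr in h3.
rewrite !pow2 -{1}ES -expRD in h4.
rewrite pow2 in h2.
split.
- by rewrite -ln_powR ler_ln ?posrE ?powR_gt0 ?ltr0n.
- rewrite normrM normfV.
  have a0 : 0 < `|a| by apply: lt_le_trans h3; apply: expR_gt0.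
  rewrite ler_pdivrMr //; apply: le_trans h2 _.
  apply: le_trans (ler_wpM2l (expR_ge0 _) h3).
  rewrite -expRD ler_expR; lra.
apply: le_trans h4 _; rewrite ge_max !ler_expR; apply/andP; split.
  have : eta * ln S <= ln S by rewrite ler_piMl.
  lra.
have : An * ln 2 <= An by rewrite ler_piMr.
lra.
Qed.
End Growth.

(** * Non-vanishing at the partial sums, and clearing of denominators *)

(** Supplies the hypothesis of [dominated_weight_inj]. [M] is non-decreasing, so the lower sum is at
    most [K] times its last term, and [D * K] times that term stays below the next one. *)
Lemma fast_growth_dominates (K D : nat) (M : nat -> nat) :
  (0 < M 1)%N ->
  (forall k, (1 < k <= K)%N -> ((D * K).+1 * (1 + M k.-1) <= M k)%N) ->
  forall k : 'I_K, (D * \sum_(j < K | (j < k)%N) M j.+1 < M k.+1)%N.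
Proof.
move=> M1 hM k; case: k => -[|k] /= kK; first by rewrite big_pred0 // muln0.
have mono i j : (1 <= i <= j)%N -> (j <= K)%N -> (M i <= M j)%N.
  move=> /andP[i1]; elim: j => [|j IH]; first by case: i i1.
  rewrite leq_eqVlt => /predU1P[->//|]; rewrite ltnS => ij jK.
  have h1 := hM j.+1; rewrite jK andbT /= in h1.
  have h2 := h1 (leq_trans i1 ij).
  have := IH ij (ltnW jK); nia.
have hs : (\sum_(j < K | (j < k.+1)%N) M j.+1 <= K * M k.+1)%N.
  apply: (@leq_trans (\sum_(j < K) M k.+1)); last first.
    by rewrite sum_nat_const card_ord.
  rewrite big_mkcond /=; apply: leq_sum => j _; case: ifP => // jk.
  by apply: mono => //; apply: ltnW.
apply: leq_trans (hM k.+2 kK); apply: (@leq_ltn_trans (D * K * M k.+1)).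
  by rewrite -mulnA leq_mul.
by rewrite /= mulSn mulnDr; lia.
Qed.

(** An infinite set of primes has a member exceeding every numerator and denominator of the
    coefficients. *)
Lemma infinite_primes_unit (P : set nat) (I : eqType) (r : seq I) (c : I -> rat) :
  (forall p, P p -> prime p) -> infinite_set P ->
  (forall m, m \in r -> c m != 0) ->
  exists2 p, P p & forall m, m \in r -> padic_unit p (c m).
Proof.
move=> Pp Pinf c0.
pose B := (\sum_(m <- r) (`|numq (c m)| + `|denq (c m)|))%N.
have [p [Pp1 Bp]] : exists p, P p /\ (B < p)%N.
  apply: contrapT => H; apply: Pinf.
  apply: (sub_finite_set (B := `I_B.+1)); last exact: finite_II.
  move=> p hp /=; rewrite ltnS leqNgt; apply/negP => h.
  by apply: H; exists p.
exists p => // m mr.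
have hB : (`|numq (c m)| + `|denq (c m)| < p)%N.
  by apply: leq_ltn_trans Bp; rewrite /B (big_rem m) //= leq_addr.
exists (numq (c m)), (denq (c m)); split; last by rewrite divq_num_den.
  rewrite dvdzE /= gtnNdvd //; first by rewrite absz_gt0 numq_eq0 c0.
  exact: leq_ltn_trans (leq_addr _ _) hB.
rewrite dvdzE /= gtnNdvd //; first by rewrite absz_gt0 denq_neq0.
exact: leq_ltn_trans (leq_addl _ _) hB.
Qed.

Lemma prod_denq_clears (I : eqType) (r : seq I) (c : I -> rat) m : m \in r ->
  (\prod_(i <- r) denq (c i))%:~R * c m \is a Num.int.
Proof.
move=> mr; rewrite (big_rem m) //= rmorphM /= mulrAC.
by rewrite -[X in _ * X * _]divq_num_den mulrCA divff ?intr_eq0 ?denq_neq0 // mulr1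
  -rmorphM intr_int.
Qed.

Lemma prod_clears_partial_sum (a b : nat -> int) (N : nat) :
  (forall n, (1 <= n)%N -> a n != 0) ->
  (\prod_(1 <= n < N) a n)%:~R * \sum_(1 <= n < N) ((b n)%:~R / (a n)%:~R : rat)
    \is a Num.int.
Proof.
move=> a0; rewrite mulr_sumr big_seq; apply: rpred_sum => n nN.
rewrite (big_rem n) //= rmorphM /=.
have an0 : (a n)%:~R != 0 :> rat.
  by rewrite intr_eq0 a0 //; move: nN; rewrite mem_index_iota => /andP[].
set Q := \prod_(_ <- _) _.
have -> : (a n)%:~R * Q%:~R * ((b n)%:~R / (a n)%:~R) = (Q * b n)%:~R :> rat.
  by rewrite rmorphM /=; field.
exact: intr_int.
Qed.

(** The prime is chosen after the coefficients, and [D] bounds all exponents. The ratios of maxima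
    eventually exceed [D * K + 1], which makes the weights of the monomials distinct. *)
Lemma eventually_eval_neq0 (R : realType) (K : nat) (P : set nat)
    (a b : nat -> nat -> int) (I : eqType) (r : seq I) (c : I -> rat)
    (e : I -> 'I_K -> nat) :
  (0 < K)%N -> (forall p, P p -> prime p) -> infinite_set P ->
  (forall k n, (1 <= k <= K)%N -> (1 <= n)%N -> a k n != 0) ->
  (forall p k, P p -> (1 <= k <= K)%N ->
     [/\ forall n, (1 <= n)%N -> ~~ (p %| gcdn `|a k n| `|b k n|)%N,
         \forall N \near \oo,
            exists! n, (1 <= n <= N)%N /\ nu p (a k n) = maxnu p (a k) N
       & (1 < k)%N ->
           (fun N => ((maxnu p (a k) N)%:R / (1 + maxnu p (a k.-1) N)%:R : R))
             @ \oo --> +oo]) ->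
  uniq r -> r != [::] -> (forall m, m \in r -> c m != 0) ->
  {in r &, forall m m', e m =1 e m' -> m = m'} ->
  \forall N \near \oo, \sum_(m <- r) c m *
    \prod_(k < K) (\sum_(1 <= n < N.+1) (b k.+1 n)%:~R / (a k.+1 n)%:~R) ^+ e m k != 0.
Proof.
move=> K0 Pp Pinf a0 hp ur r0 c0 einj.
have [p Pp1 cunit] := infinite_primes_unit P I r c Pp Pinf c0.
have pp := Pp p Pp1.
pose D := (\sum_(m <- r) \sum_k e m k)%N.
have eD m k : m \in r -> (e m k <= D)%N.
  move=> mr; rewrite /D (big_rem m) //= (bigD1 k) //= -addnA leq_addr //.
have uniq_max : \forall N \near \oo, forall k : 'I_K,
    exists! n, (1 <= n <= N)%N /\ nu p (a k.+1 n) = maxnu p (a k.+1) N.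
  by apply: filter_forall => k; have [] := hp p k.+1 Pp1 (ltn_ord k).
(* The ordinal [k] stands for the index [k + 1] of the sequences, so [0 < k] is the case where a
   preceding sequence exists. *)
have growth : \forall N \near \oo, forall k : 'I_K, (0 < k)%N ->
    ((D * K).+1 * (1 + maxnu p (a k) N) <= maxnu p (a k.+1) N)%N.
  apply: filter_forall => k.
  have [k0|k0] := posnP k; first by apply: nearW.
  have [_ _ /(_ k0) /cvgryPge /(_ (D * K).+1%:R)] := hp p k.+1 Pp1 (ltn_ord k).
  apply: filterS => N /= + _.
  by rewrite ler_pdivlMr ?ltr0n // -natrM ler_nat.
near=> N.
have N1 : (1 < N)%N by near: N; exact: nbhs_infty_ge.
have uN : forall k : 'I_K,
    exists! n, (1 <= n <= N)%N /\ nu p (a k.+1 n) = maxnu p (a k.+1) N.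
  by near: N.
have gN : forall k : 'I_K, (0 < k)%N ->
    ((D * K).+1 * (1 + maxnu p (a k) N) <= maxnu p (a k.+1) N)%N.
  by near: N.
apply: (padic_eval_neq0 K I r c e p (fun k => maxnu p (a k.+1) N)) => //.
  move=> k; apply: partial_sum_padic_unit => //.
    by move=> n; exact: (a0 k.+1 n (ltn_ord k)).
  by have [] := hp p k.+1 Pp1 (ltn_ord k).
move=> m m' mr mr' /= Wmm'; apply: einj => //.
apply: (dominated_weight_inj K D (fun k => maxnu p (a k.+1) N)) => //.
- apply: (fast_growth_dominates K D (fun k => maxnu p (a k) N)).
    (* If the first maximum were 0, both indices 1 and 2 would attain it, against uniqueness. *)
    have [n0 [[n0N n0M] n0u]] := uN (Ordinal K0).
    rewrite lt0n; apply/negP => /eqP M0.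
    have all0 n : (1 <= n <= N)%N -> n0 = n.
      move=> nN; apply: n0u; split => //; rewrite [RHS]M0; apply/eqP.
      rewrite -leqn0 -[leqRHS]M0 /maxnu.
      by apply: (@leq_bigmax_seq _ _ xpredT (fun m => nu p (a 1%N m))); rewrite ?mem_index_iota.
    have := all0 1%N; rewrite (ltnW N1) => /(_ isT) e1.
    by have := all0 2%N; rewrite N1 e1 => /(_ isT).
  move=> [|k] // /andP[k1 kK]; have := gN (Ordinal kK); exact.
- by move=> k; apply: eD.
- by move=> k; apply: eD.
Unshelve. all: by end_near.
Qed.

(** * Approximation along records, and the contradiction *)

(** At a record [N.+1] the products of denominators cost a constant times [s_{N+1}^(eta/2)], while
    the tails are at most [(4 / eps) s_{N+1}^(-eta)]. The surplus [s_{N+1}^(-eta/2)] absorbs every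
    constant once [N] is large. *)
Lemma good_approximations (R : realType) (K : nat) (eps kappa : R)
    (a b : nat -> nat -> int) (s : nat -> nat) (A0 : int) :
  (0 < K)%N -> 0 < eps -> 0 < kappa -> kappa < 1 ->
  (forall n, (1 <= n)%N -> (0 < s n)%N /\ (s n <= s n.+1)%N) ->
  (forall k A, (1 <= k <= K)%N -> A0 <= A ->
     \forall n \near \oo,
       [/\ n%:R `^ (1 + eps) <= (s n)%:R :> R,
           (s n <= s n.+1)%N,
           `|(b k n)%:~R| <= 2 `^ ((ln (s n)%:R / ln 2) `^ kappa) :> R,
           (s n)%:R * 2 `^ (- (ln (s n)%:R / ln 2) `^ kappa) <= `|(a k n)%:~R| :> R
         & `|(a k n)%:~R| <=
             Num.max ((s n)%:R * 2 `^ ((ln (s n)%:R / ln 2) `^ kappa))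
                     (2 `^ ((A ^+ n)%:~R)) :> R]) ->
  (forall A, A0 <= A ->
     limn_esup (fun n => (((s n)%:R `^ ((A ^+ n)%:~R)^-1 : R))%:E) = +oo%E) ->
  let u := fun (k : 'I_K) N =>
    \sum_(1 <= n < N) ((b k.+1 n)%:~R / (a k.+1 n)%:~R : R) in
  forall (D : nat) (Z : R) (N0 : nat), 0 <= Z ->
  exists N d, [/\ (N0 <= N)%N, 0 <= d <= 4 / eps,
    forall k, `|limn (u k) - u k N.+1| <= d &
    Z * (\prod_(k < K) `|\prod_(1 <= n < N.+1) (a k.+1 n)%:~R| ^+ D) * d < 1].
Proof.
move=> Kpos eps0 kappa0 kappa1 hs hgrow hsup u D Z N0 Z0.
pose eta := eps / (4 * (1 + eps)).
have eta0 : 0 < eta by rewrite divr_gt0 // mulr_gt0 // addr_gt0.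
have eta1 : eta <= 1.
  by rewrite ler_pdivrMr ?mulr_gt0 ?addr_gt0 //; move: eps0; lra.
(* The base [A] is taken so large that [prod |a_{k,n}|^D <= C s_{N+1}^(eta/2)] at records. *)
pose A := (`|A0| + 2 + Num.bound (6 * (K * D)%:R / eta))%N.
have A0A : A0 <= A%:Z by rewrite (le_trans (ler_norm A0)) // -abszE lez_nat /A -addnA leq_addr.
have A2 : 2 <= A%:R :> R by rewrite ler_nat /A addnAC leq_addl.
have A1 : 1 < A%:R :> R by apply: lt_le_trans A2; rewrite ltr1n.
have Aeta : (K * D)%:R * (3 / (A%:R - 1)) <= eta / 2.
  have h : 6 * (K * D)%:R / eta < A%:R - 1 :> R.
    have h1 := archi_boundP (divr_ge0 (mulr_ge0 (ler0n R 6) (ler0n R (K * D))) (ltW eta0)).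
    apply: lt_le_trans h1 _; by rewrite lerBrDr natr1 ler_nat /A -add1n leq_add // addn2.
  rewrite ltr_pdivrMr // in h.
  rewrite mulrA ler_pdivrMr ?subr_gt0 //; lra.
pose L n := ln (s n)%:R : R.
have [X X0 hX] := powR_sublinear R kappa eta (introT andP (conj kappa0 kappa1)) eta0.
have l20 : 0 < ln 2 :> R by rewrite ln_gt0 // ltr1n.
have s1 n : (1 <= n)%N -> 1 <= (s n)%:R :> R by move=> /hs[]; rewrite ler1n.
have ev : \forall n \near \oo, forall k : 'I_K,
    [/\ (1 + eps) * ln n%:R <= L n,
      `|(b k.+1 n)%:~R / (a k.+1 n)%:~R| <= expR (- (1 - 2 * eta) * L n)
    & `|(a k.+1 n)%:~R| <= expR (2 * L n + A%:R ^+ n)].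
  apply: filter_forall => k; near=> n.
  have n1 : (1 <= n)%N by near: n; exact: nbhs_infty_ge.
  have [h1 _ h2 h3 h4] : [/\ n%:R `^ (1 + eps) <= (s n)%:R :> R,
           (s n <= s n.+1)%N,
           `|(b k.+1 n)%:~R| <= 2 `^ ((ln (s n)%:R / ln 2) `^ kappa) :> R,
           (s n)%:R * 2 `^ (- (ln (s n)%:R / ln 2) `^ kappa) <= `|(a k.+1 n)%:~R| :> R
         & `|(a k.+1 n)%:~R| <=
             Num.max ((s n)%:R * 2 `^ ((ln (s n)%:R / ln 2) `^ kappa))
                     (2 `^ ((A%:Z ^+ n)%:~R)) :> R].
    by near: n; apply: hgrow => //; exact: ltn_ord.
  have An : (A%:Z ^+ n)%:~R = A%:R ^+ n :> R by rewrite rmorphXn.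
  rewrite An in h4.
  apply: (growth_bounds R (s n)%:R eps kappa) => //.
  - by rewrite (ltW eta0).
  - exact: s1.
  - apply: hX; rewrite ler_pdivlMr //.
    have n1' : 0 < n%:R :> R by rewrite ltr0n.
    (* As [s n >= n^(1 + eps) >= n], this forces log_2 of [s n] past the threshold [X]. *)
    have hn : expR (X * ln 2) <= n%:R by near: n; exact: nbhs_infty_ger.
    rewrite -[X * ln 2]expRK ler_ln ?posrE ?expR_gt0 ?(lt_le_trans ltr01) ?s1 //.
    apply: le_trans hn (le_trans _ h1).
    by apply: le1r_powR; rewrite ?ler1n // lerDl ltW.
have [n0 _ hn0] := ev.
pose n1 := n0.+1.
have {}ev k n : (n1 <= n)%N ->
    [/\ (1 + eps) * ln n%:R <= L n,
      `|(b (@nat_of_ord K k).+1 n)%:~R / (a k.+1 n)%:~R| <= expR (- (1 - 2 * eta) * L n)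
    & `|(a k.+1 n)%:~R| <= expR (2 * L n + A%:R ^+ n)].
  by move=> h; apply: hn0; apply: ltnW.
have s_mono m n : (1 <= m)%N -> (m <= n)%N -> (s m <= s n)%N.
  move=> m1 /subnK <-; elim: (n - m)%N => [|i IH] //.
  rewrite addSn; apply: leq_trans IH (proj2 (hs _ _)).
  by rewrite (leq_trans m1) // leq_addl.
have L_mono m n : (n1 <= m)%N -> (m <= n)%N -> L m <= L n.
  move=> m1 mn; have m0 : (1 <= m)%N by apply: leq_trans m1.
  rewrite ler_ln ?posrE ?ltr0n; [|exact: (proj1 (hs _ _))..|].
    by rewrite ler_nat s_mono.
  by apply: (proj1 (hs _ _)); apply: leq_trans mn.
have L_ge0 n : (1 <= n)%N -> 0 <= L n by move=> h; apply: ln_ge0; apply: s1.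
have /fin_all_exists2[C C0 hC] (k : 'I_K) := record_prod_le R (a k.+1) L A%:R n1 A1 isT
  (fun n h => let: And3 _ _ x := ev k n h in x).
(* The logarithm of [s_n^(1/A^n)] is [L n / A^n], so the limsup hypothesis makes this ratio
   unbounded. *)
have unb B N : exists2 n, (N <= n)%N & B <= L n / A%:R ^+ n.
  have [n nN h] := limn_esup_pinfty_unbounded R _ (hsup A%:Z A0A) (expR B) N.+1.
  exists n; first exact: ltnW.
  rewrite -[B]expRK; apply: le_trans (_ : ln ((s n)%:R `^ ((A%:Z ^+ n)%:~R)^-1) <= _).
    rewrite ler_ln ?posrE ?expR_gt0 //; exact: lt_le_trans (expR_gt0 _) h.
  by rewrite ln_powR mulrC rmorphXn.
(* All factors that do not depend on [N]; the goal reduces to [W < exp(eta/2 * L N.+1)]. *)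
pose W := Z * (\prod_k C k ^+ D) * (4 / eps).
have W0 : 0 <= W.
  by rewrite !mulr_ge0 // ?prodr_ge0 ?invr_ge0 ?(ltW eps0) // => k _; rewrite exprn_ge0.
(* For [N >= N2], [L N.+1 >= ln (N + 1) >= 2 W / eta], whence [W <= eta/2 * L N.+1]. *)
pose N2 := Num.bound (expR (2 / eta * W)).
have [N [NN r1 rmax]] := exists_record R _ unb (N0 + n1 + N2)%N.
have n1N : (n1 <= N)%N by apply: leq_trans NN; rewrite addnAC leq_addl.
have L0 := L_ge0 N.+1 isT.
exists N, (expR (- eta * L N.+1) * (4 / eps)); split.
- by apply: leq_trans NN; rewrite -addnA leq_addr.
- rewrite mulr_ge0 ?expR_ge0 ?divr_ge0 ?(ltW eps0) //=.
  rewrite ler_piMl ?divr_ge0 ?(ltW eps0) //.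
  by rewrite -[leRHS]expR0 ler_expR mulNr oppr_le0 mulr_ge0 ?(ltW eta0).
- move=> k; apply: (proj2 (tail_limit_le R _ L eps n1 eps0 isT L_mono _ _)) => //.
    by move=> n /(ev k)[].
  by move=> n /(ev k)[].
have Apos n : 0 < A%:R ^+ n :> R by rewrite exprn_gt0 // (lt_trans ltr01).
have hQ : \prod_(k < K) `|\prod_(1 <= n < N.+1) (a k.+1 n)%:~R| ^+ D <=
    (\prod_k C k ^+ D) * expR (eta / 2 * L N.+1).
  apply: (@le_trans _ _ (\prod_(k < K) (C k ^+ D * expR (3 / (A%:R - 1) * L N.+1) ^+ D))).
    apply: ler_prod => k _; rewrite exprn_ge0 //= -exprMn.
    rewrite lerXn2r ?nnegrE ?mulr_ge0 ?expR_ge0 //.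
    (* With [rho] the record value, [rho * A^(N+1)] is [L N.+1] itself. *)
    have := hC k N (L N.+1 / A%:R ^+ N.+1) n1N r1.
    rewrite mulfVK ?lt0r_neq0 //; apply => n nN.
    by rewrite -ler_pdivrMr // rmax.
  rewrite big_split /= ler_wpM2l ?prodr_ge0 // => [k _|]; first by rewrite exprn_ge0.
  rewrite big_const_ord iter_mulr_1 -exprM -expRM_natl ler_expR mulrA.
  by rewrite ler_wpM2r // mulnC.
have hL : 2 / eta * W <= L N.+1.
  have NR : expR (2 / eta * W) <= N.+1%:R.
    apply: le_trans (ltW (archi_boundP (expR_ge0 _))) _.
    by rewrite ler_nat (leq_trans _ (leqW NN)) // leq_addl.
  have [h _ _] := ev (Ordinal Kpos) N.+1 (leqW n1N).
  apply: le_trans h; rewrite -[leLHS]expRK.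
  apply: (@le_trans _ _ (ln N.+1%:R)); first by rewrite ler_ln ?posrE ?expR_gt0 ?ltr0n.
  by rewrite ler_peMl ?ln_ge0 ?ler1n // lerDl ltW.
have hLW : W <= eta / 2 * L N.+1.
  have := ler_wpM2l (ltW (divr_gt0 eta0 (ltr0n R 2))) hL.
  by rewrite mulrA mulf_div (mulrC eta 2) divff ?mul1r // mulf_neq0 ?lt0r_neq0.
apply: (@le_lt_trans _ _ (W * expR (- (eta / 2 * L N.+1)))).
  have -> : W * expR (- (eta / 2 * L N.+1)) =
    Z * ((\prod_k C k ^+ D) * expR (eta / 2 * L N.+1)) * (expR (- eta * L N.+1) * (4 / eps)).
    have -> : - (eta / 2 * L N.+1) = eta / 2 * L N.+1 + - eta * L N.+1 by field.
    by rewrite expRD /W; ring.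
  rewrite ler_wpM2r ?ler_wpM2l //.
  by rewrite mulr_ge0 ?expR_ge0 ?divr_ge0 ?(ltW eps0).
rewrite expRN ltr_pdivrMr ?expR_gt0 // mul1r.
apply: le_lt_trans hLW _; apply: lt_le_trans (expR_ge1Dx _).
by rewrite ltrDr.
Unshelve. all: by end_near.
Qed.

(* a k n = a_{k,n}, b k n = b_{k,n} (k = 1..K, n >= 1); s n = a_n;
   log_2 x is written  ln x / ln 2. *)
Theorem theorem6 (R : realType) (K : nat) (P : set nat) (eps kappa : R)
    (a b : nat -> nat -> int) (s : nat -> nat) (A0 : int) :
  (0 < K)%N ->
  (forall p, P p -> prime p) -> infinite_set P ->
  0 < eps -> 0 < kappa -> kappa < 1 ->
  (forall k n, (1 <= k <= K)%N -> (1 <= n)%N -> a k n != 0 /\ b k n != 0) ->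
  (forall p k, P p -> (1 <= k <= K)%N ->
     [/\ forall n, (1 <= n)%N -> ~~ (p %| gcdn `|a k n| `|b k n|)%N,
         \forall N \near \oo,
            exists! n, (1 <= n <= N)%N /\ nu p (a k n) = maxnu p (a k) N
       & (1 < k)%N ->
           (fun N => ((maxnu p (a k) N)%:R / (1 + maxnu p (a k.-1) N)%:R : R))
             @ \oo --> +oo]) ->
  (forall n, (1 <= n)%N -> (0 < s n)%N /\ (s n <= s n.+1)%N) ->
  (forall k A, (1 <= k <= K)%N -> A0 <= A ->
     \forall n \near \oo,
       [/\ n%:R `^ (1 + eps) <= (s n)%:R :> R,
           (s n <= s n.+1)%N,
           `|(b k n)%:~R| <= 2 `^ ((ln (s n)%:R / ln 2) `^ kappa) :> R,
           (s n)%:R * 2 `^ (- (ln (s n)%:R / ln 2) `^ kappa) <= `|(a k n)%:~R| :> R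
         & `|(a k n)%:~R| <=
             Num.max ((s n)%:R * 2 `^ ((ln (s n)%:R / ln 2) `^ kappa))
                     (2 `^ ((A ^+ n)%:~R)) :> R]) ->
  (forall A, A0 <= A ->
     limn_esup (fun n => (((s n)%:R `^ ((A ^+ n)%:~R)^-1 : R))%:E) = +oo%E) ->
  alg_indep_Q (fun i : 'I_K =>
    limn (fun N => \sum_(1 <= n < N) ((b i.+1 n)%:~R / (a i.+1 n)%:~R : R))).
Proof.
move=> K0 Pp Pinf eps0 kappa0 kappa1 ab0 hp hs hgrow hsup.
have a0 k n : (1 <= k <= K)%N -> (1 <= n)%N -> a k n != 0.
  by move=> hk hn; case: (ab0 k n hk hn).
move=> F F0; apply/negP => /eqP.
pose r := mpoly.msupp F; pose c m := mpoly.mcoeff m F.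
pose e m (k : 'I_K) := mpoly.fun_of_multinom m k.
set alpha := fun i : 'I_K => limn _ => F_eq0.
(* [mmap] unfolds to this sum over the support of [F]. *)
have {F_eq0} : \sum_(m <- r) ratr (c m) * \prod_k alpha k ^+ e m k = 0 by [].
move=> F_eq0.
have r0 : r != [::] by rewrite mpoly.msupp_eq0.
have c0 m : m \in r -> c m != 0 by rewrite mpoly.mcoeff_msupp.
have einj : {in r &, forall m m', e m =1 e m' -> m = m'}.
  by move=> m m' _ _ h; apply/mpoly.mnmP.
have [N1 _ hN1] := eventually_eval_neq0 R K P a b _ r c e K0 Pp Pinf a0 hp
  (mpoly.msupp_uniq F) r0 c0 einj.
pose D := (\sum_(m <- r) \sum_k e m k)%N.
have eD m k : m \in r -> (e m k <= D)%N.
  by move=> mr; rewrite /D (big_rem m) //= (bigD1 k) //= -addnA leq_addr.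
(* The box is fixed before [N]: it contains [alpha] and every point within [4 / eps] of it, hence
   the partial sums chosen below. *)
pose B := \sum_k `|alpha k| + 4 / eps.
have [C C0 lip] := lipschitz_on_box_eval R K B _ r (fun m => ratr (c m)) e.
pose den := \prod_(m <- r) denq (c m).
(* [den] clears the coefficients and [C] is the Lipschitz constant; both are known before [N] and
   enter through [Z]. *)
have [N [d [N1N /andP[d0 d4] had small]]] := good_approximations R K eps kappa a b s A0
  K0 eps0 kappa0 kappa1 hs hgrow hsup D (`|den%:~R| * C) N1 (mulr_ge0 (normr_ge0 _) C0).
pose q (k : 'I_K) : rat := \sum_(1 <= n < N.+1) (b k.+1 n)%:~R / (a k.+1 n)%:~R.
pose Q (k : 'I_K) : int := \prod_(1 <= n < N.+1) a k.+1 n.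
pose x (k : 'I_K) : R := ratr (q k).
have xE k : x k = \sum_(1 <= n < N.+1) (b k.+1 n)%:~R / (a k.+1 n)%:~R.
  rewrite /x rmorph_sum /=; apply: eq_bigr => n _.
  by rewrite fmorph_div /= !ratr_int.
have axd k : `|alpha k - x k| <= d by rewrite xE; apply: had.
have alphaB k : `|alpha k| <= B.
  rewrite /B (bigD1 k) //= -addrA lerDl addr_ge0 ?sumr_ge0 //.
  by rewrite divr_ge0 // ltW.
have xB k : `|x k| <= B.
  have -> : x k = alpha k - (alpha k - x k) by ring.
  apply: le_trans (ler_normB _ _) _; apply: lerD; last exact: le_trans (axd k) d4.
  by rewrite (bigD1 k) //= lerDl sumr_ge0.
have [_] := lip alpha x d alphaB xB axd d0.
rewrite F_eq0 sub0r normrN => ev_le.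
pose E := \sum_(m <- r) c m * \prod_k q k ^+ e m k.
have E0 : E != 0 by apply: hN1.
have Eint := cleared_eval_int K _ r c e D den Q q (prod_denq_clears _ r c) eD
  (fun k => prod_clears_partial_sum (a k.+1) (b k.+1) N.+1
     (fun n hn => a0 k.+1 n (ltn_ord k) hn)).
have Q0 k : Q k != 0.
  rewrite /Q prodf_seq_neq0; apply/allP => n; rewrite mem_index_iota => /andP[n1 _].
  by apply/implyP => _; exact: (a0 k.+1 n (ltn_ord k) n1).
have den0 : den != 0.
  by rewrite /den prodf_seq_neq0; apply/allP => m _; rewrite denq_neq0.
(* A non-zero integer has absolute value at least 1, yet this one, carried to [R], is at most
   [|den| * prod |Q k|^D * C * d], which is less than 1. *)
have := norm_intr_ge1 Eint; rewrite !mulf_neq0 ?intr_eq0 //; last first.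
  by apply/prodf_neq0 => k _; rewrite expf_neq0 // intr_eq0.
move=> /(_ isT); rewrite -(ler_rat R) rmorph1 ratr_norm leNgt => /negP; apply.
rewrite 2!rmorphM /= ratr_int -/E.
have -> : ratr E = \sum_(m <- r) ratr (c m) * \prod_k x k ^+ e m k :> R.
  rewrite rmorph_sum /=; apply: eq_bigr => m _; rewrite rmorphM rmorph_prod /=.
  by congr (_ * _); apply: eq_bigr => k _; rewrite rmorphXn.
have -> : ratr (\prod_(k < K) (Q k)%:~R ^+ D) =
    \prod_(k < K) (\prod_(1 <= n < N.+1) (a k.+1 n)%:~R) ^+ D :> R.
  rewrite rmorph_prod /=; apply: eq_bigr => k _.
  by rewrite rmorphXn /= ratr_int rmorph_prod.
apply: le_lt_trans small; rewrite 2!normrM normr_prod.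
rewrite (eq_bigr _ (fun k _ => normrX _ _)).
set pr := \prod_(k < K) _.
have -> : `|den%:~R| * C * pr * d = `|den%:~R| * pr * (C * d) by ring.
rewrite ler_wpM2l // mulr_ge0 //.
by apply: prodr_ge0 => k _; rewrite exprn_ge0.
Qed.
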